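(* For every real number $L \in [0, 2/\pi]$ there exists a set $I \subseteq \mathbb{N}$ such that the limit $\lim_{n\to\infty} \left( d_n(I)/n! \right)^{1/n}$ exists and equals $L$.
   Context: $\mathbb{N}=\{1,2,3,\ldots\}$, $[n-1]=\{1,\ldots,n-1\}$, and $\mathfrak{S}_n$ is the symmetric group on $[n]$, with permutations written in one-line notation $\pi=\pi_1\cdots\pi_n$. A descent of $\pi$ is an index $i\in[n-1]$ with $\pi_i>\pi_{i+1}$. For $I\subseteq\mathbb{N}$, $d_n(I)$ denotes the number of $\pi\in\mathfrak{S}_n$ whose set of descents is exactly $I\cap[n-1]$. *)

(* Defs.v *)
From HB Require Import structures.
From mathcomp Require Import all_boot all_order all_fingroup all_algebra.
From mathcomp Require Import all_classical all_reals all_analysis.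

Set Implicit Arguments.
Unset Strict Implicit.
Unset Printing Implicit Defensive.

Local Open Scope classical_set_scope.

(* Positions and values of [p : 'S_n] are 0-based in MathComp, while descents
   are 1-based: the i-th letter of the one-line notation is [p j] with
   [j.+1 = i], and the next letter is [p k] with [k = j.+1]. *)
Definition descents (n : nat) (p : 'S_n) : set nat :=
  [set i | exists j k : 'I_n, [/\ i = j.+1, k = j.+1 :> nat & p j > p k]].

Definition d (n : nat) (I : set nat) : nat :=
  #|[pred p : 'S_n | `[< descents p = I `&` [set i | 1 <= i < n] >] ]|.

(* Main.v *)
Require Import Defs.
From HB Require Import structures.
From mathcomp Require Import all_boot all_order all_fingroup all_algebra.
From mathcomp Require Import all_classical all_reals all_analysis.
From mathcomp Require Import zify ring lra.

Set Implicit Arguments.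
Unset Strict Implicit.
Unset Printing Implicit Defensive.

Import Order.TTheory GRing.Theory Num.Theory.
Import numFieldNormedType.Exports.
Local Open Scope classical_set_scope.
Local Open Scope ring_scope.

(** Write [a(u)] for the proportion of permutations with descent word [u].
    Restricting a permutation to an initial and a final block of positions and
    standardizing gives [a(u Up v) + a(u Down v) = a(u) a(v)]. Hence [a] is
    submultiplicative, and of the two ways of gluing [v] to [u] the better one
    loses at most a factor 2.

    For alternating words of even length this identity telescopes to
    [sum_k (-1)^k e_(n-k) / (2k)! = 0], so that the polynomials
    [F_n(x) = sum_k (-1)^k e_(n-k) x^(2k) / (2k)!] satisfy [F_n'' = - F_(n-1)],
    [F_n'(0) = 0] and [F_n(1) = 0]; comparing them with the eigenfunction
    [cos (pi x / 2)] gives [e_n = Theta((2/pi)^(2n))]. This settles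
    [L = 2/pi], and increasing permutations settle [L = 0].

    For [0 < L < 2/pi] fix a block length [l] with [1/l! <= L^l] and
    [a(alternating block) >= 2 L^l], and append blocks greedily: an increasing
    one if [a(u) > L^|u|], an alternating one otherwise, always with the better
    gluing. Then [a(u) / L^|u|] stays between two positive constants. *)

(** * Counting permutations with a prescribed descent pattern *)

Section Patterns.
Local Open Scope nat_scope.
Implicit Types (V W : nat -> bool).

(* [W k] prescribes whether [k] is a descent in the 1-based convention of
   [descents]; only [W 1, ..., W (n - 1)] matter. *)
Definition has_pattern n (W : nat -> bool) (f : 'I_n -> nat) : bool :=
  [forall j : 'I_n, forall k : 'I_n, (k == j.+1 :> nat) ==> ((f k < f j) == W k)].

Definition pattern_count n (W : nat -> bool) : nat :=
  #|[pred p : 'S_n | has_pattern W (fun i => p i)]|.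

Lemma has_patternP n W (f : 'I_n -> nat) :
  reflect (forall j k : 'I_n, k = j.+1 :> nat -> (f k < f j) = W k)
          (has_pattern W f).
Proof.
apply: (iffP forallP) => [H j k kj|H j].
  by move/forallP/(_ k): (H j); rewrite kj eqxx => /eqP.
by apply/forallP => k; apply/implyP => /eqP kj; apply/eqP/H.
Qed.

Lemma d_pattern_count n (I : set nat) :
  d n I = pattern_count n (fun i => `[< I i >]).
Proof.
apply: eq_card => p; rewrite !inE; apply/asboolP/has_patternP => [E j k kj|H].
  apply/idP/asboolP => [lt_p|Ik].
    have : descents p k by exists j, k.
    by rewrite E => -[].
  have : descents p k.
    by rewrite E; split=> //=; rewrite kj /= -kj ltn_ord.
  case=> j' [k' [kj' kj'']]; rewrite kj' in kj kj''.
  have -> : j' = j by apply/val_inj; case: kj.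
  by have -> : k' = k by apply/val_inj; rewrite /= kj'' kj'.
apply/seteqP; split=> [i [j [k [-> kj lt_p]]]|i [Ii /= /andP[i1 lt_in]]].
  split; last by rewrite /= -kj ltn_ord.
  by rewrite -kj; apply/asboolP; rewrite -(H j).
have lt_in' : i.-1 < n by rewrite (leq_ltn_trans (leq_pred _)).
exists (Ordinal lt_in'), (Ordinal lt_in); split; rewrite /= ?prednK //.
by rewrite (H (Ordinal lt_in')) /= ?prednK //; apply/asboolP.
Qed.

Lemma eq_has_pattern n W (f g : 'I_n -> nat) :
  (forall i j, (f i < f j) = (g i < g j)) -> has_pattern W f = has_pattern W g.
Proof.
by move=> H; apply: eq_forallb => j; apply: eq_forallb => k; rewrite H.
Qed.

Lemma eq_pattern_count n V W :
  (forall i, 0 < i < n -> V i = W i) -> pattern_count n V = pattern_count n W.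
Proof.
move=> VW; apply: eq_card => p; rewrite !inE.
apply: eq_forallb => j; apply: eq_forallb => k.
by case: eqP => //= kj; rewrite VW // kj /= -kj.
Qed.

(** The number of values of [f] below [f i] is a rank smaller than [n], and injectivity of [f] keeps
    the ranks distinct. *)
Lemma standardization n (f : 'I_n -> nat) : injective f ->
  exists s : 'S_n, forall i j, (s i < s j) = (f i < f j).
Proof.
move=> f_inj; pose r (i : 'I_n) := #|[pred j | f j < f i]|.
have lt_r i j : f i < f j -> r i < r j.
  move=> lt_f; apply/proper_card/properP; split.
    by apply/fintype.subsetP => k; rewrite !inE => /ltn_trans; apply.
  by exists i; rewrite !inE ?ltnn.
have r_n i : r i < n.
  rewrite -[X in _ < X]card_ord; apply/proper_card/properP; split.
    exact/fintype.subsetP.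
  by exists i; rewrite !inE ?ltnn.
have E i j : (r i < r j) = (f i < f j).
  case: (ltngtP (f i) (f j)) => [/lt_r //|/lt_r/ltnW|/f_inj ->].
    by rewrite leqNgt => /negbTE.
  by rewrite ltnn.
have s_inj : injective (fun i => Ordinal (r_n i)).
  move=> i j [rij]; apply: f_inj.
  by have := E i j; have := E j i; rewrite rij ltnn; case: ltngtP.
by exists (perm s_inj) => i j; rewrite !permE E.
Qed.

(** If [t] standardizes [f], then [i |-> f (s i)] is ordered like [s * t], products acting from left
    to right, and right multiplication by [t] is a bijection of ['S_n]. *)
Lemma pattern_count_translate n W (f : 'I_n -> nat) : injective f ->
  #|[pred s : 'S_n | has_pattern W (fun i => f (s i))]| = pattern_count n W.
Proof.
move=> /standardization[t Et].
rewrite -(card_imset _ (mulIg t)) /pattern_count; apply: eq_card => s.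
rewrite !inE; apply/imsetP/idP => [[s' + ->]|Hs].
  rewrite inE; congr (is_true _); apply: eq_has_pattern => i j.
  by rewrite !permM Et.
exists (s * t^-1)%g; last by rewrite mulgKV.
rewrite inE; move: Hs; congr (is_true _); apply: eq_has_pattern => i j.
by rewrite -Et !permM !permKV.
Qed.

(** * Splitting the positions into two blocks *)

Definition sum_perm_fun m n (s : 'S_m) (t : 'S_n) (x : 'I_(m + n)) :
    'I_(m + n) :=
  match fintype.split x with
  | inl i => lshift n (s i)
  | inr j => rshift m (t j)
  end.

Lemma sum_perm_funK m n (s : 'S_m) (t : 'S_n) :
  cancel (sum_perm_fun s t) (sum_perm_fun s^-1 t^-1).
Proof.
move=> x; rewrite /sum_perm_fun -[RHS]splitK; case: (fintype.split x) => i.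
  by rewrite (unsplitK (inl (s i))) /= permK.
by rewrite (unsplitK (inr (t i))) /= permK.
Qed.

Definition sum_perm m n (s : 'S_m) (t : 'S_n) : 'S_(m + n) :=
  perm (can_inj (sum_perm_funK s t)).

Lemma sum_permL m n (s : 'S_m) (t : 'S_n) i :
  sum_perm s t (lshift n i) = lshift n (s i).
Proof. by rewrite permE /sum_perm_fun (unsplitK (inl i)). Qed.

Lemma sum_permR m n (s : 'S_m) (t : 'S_n) i :
  sum_perm s t (rshift m i) = rshift m (t i).
Proof. by rewrite permE /sum_perm_fun (unsplitK (inr i)). Qed.

Definition split_pattern m n (W : nat -> bool) (f : 'I_(m + n) -> nat) : bool :=
  has_pattern W (fun i => f (lshift n i)) &&
  has_pattern (fun i => W (m + i)) (fun i => f (rshift m i)).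

(* Average over the action of ['S_m * 'S_n] on positions: for fixed [p], the
   pairs [(s, t)] giving the right pattern are counted by translating by the
   standardizations of the two halves of [p]. *)
Lemma card_split_pattern m n W :
  m`! * n`! * #|[pred p : 'S_(m + n) | split_pattern W (fun i => p i)]| =
  (m + n)`! * (pattern_count m W * pattern_count n (fun i => W (m + i))).
Proof.
pose X (p : 'S_(m + n)) := split_pattern W (fun i => p i).
transitivity (\sum_(s : 'S_m) \sum_(t : 'S_n) \sum_(p : 'S_(m + n))
                X (sum_perm s t * p)%g).
  have E s t : \sum_(p : 'S_(m + n)) X (sum_perm s t * p)%g = #|X|.
    rewrite -sum1_card [RHS]big_mkcond /= (reindex_inj (mulgI (sum_perm s t)^-1%g)).
    by apply: eq_bigr => p _; rewrite mulKVg unfold_in /X; case: split_pattern.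
  under eq_bigr => s _ do under eq_bigr => t _ do rewrite E.
  by rewrite !sum_nat_const !card_Sn mulnA.
under eq_bigr => s _ do rewrite exchange_big.
rewrite exchange_big /= -(card_Sn (m + n)) -sum_nat_const.
apply: eq_bigr => p _.
rewrite -(@pattern_count_translate m W (fun i => p (lshift n i))); last first.
  by move=> i j /val_inj/perm_inj/lshift_inj.
rewrite -(@pattern_count_translate n _ (fun i => p (rshift m i))); last first.
  by move=> i j /val_inj/perm_inj/rshift_inj.
rewrite -!sum1_card big_distrl /= [RHS]big_mkcond; apply: eq_bigr => s _ /=.
rewrite mul1n [X in if _ then X else _]big_mkcond /=.
have E t : X (sum_perm s t * p)%g =
    has_pattern W (fun i => p (lshift n (s i))) &&
    has_pattern (fun i => W (m + i)) (fun i => p (rshift m (t i))).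
  congr andb; apply: eq_has_pattern => i j.
    by rewrite !permM !sum_permL.
  by rewrite !permM !sum_permR.
under eq_bigr => t _ do rewrite E.
by rewrite !inE; case: has_pattern => /=; last by rewrite big1.
Qed.

Definition flip m (W : nat -> bool) : nat -> bool :=
  fun i => (i == m) (+) W i.

(** The only consecutive positions not lying in a common block are the last of the first block and
    the first of the second. *)
Lemma has_pattern_cat m n W (f : 'I_(m.+1 + n.+1) -> nat) :
  has_pattern W f = split_pattern W f &&
    ((f (rshift m.+1 ord0) < f (lshift n.+1 ord_max)) == W m.+1).
Proof.
apply/has_patternP/andP => [H|[/andP[/has_patternP Hl /has_patternP Hr] /eqP Hm]].
  split; last by apply/eqP; rewrite H //= addn0.
  apply/andP; split; apply/has_patternP => j k kj; rewrite H //=.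
  by rewrite kj addnS.
move=> j k.
case: (fintype.split_ordP j) => j' ->; case: (fintype.split_ordP k) => k' -> /=.
- exact: Hl.
- move=> E; have k0 : k' = ord0.
    by apply/val_inj => /=; have := ltn_ord j'; lia.
  have jm : j' = ord_max by apply/val_inj => /=; rewrite k0 /= in E; lia.
  by rewrite k0 jm Hm /= addn0.
- by have := ltn_ord k'; lia.
- by rewrite -addnS => /addnI; exact: Hr.
Qed.

Lemma pattern_count_flip m n W :
  pattern_count (m.+1 + n.+1) W + pattern_count (m.+1 + n.+1) (flip m.+1 W) =
  #|[pred p : 'S_(m.+1 + n.+1) | split_pattern W (fun i => p i)]|.
Proof.
pose c := [pred p : 'S_(m.+1 + n.+1) |
   (p (rshift m.+1 ord0) < p (lshift n.+1 ord_max)) == W m.+1].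
rewrite -(cardID c); congr (_ + _); apply: eq_card => p; rewrite !inE /=.
  by rewrite has_pattern_cat andbC.
rewrite has_pattern_cat andbC [flip _ _ m.+1]/flip eqxx addTb; congr andb.
  by case: (_ < _); case: (W _).
congr andb; apply: eq_forallb => j; apply: eq_forallb => k; rewrite /flip.
  by rewrite (ltn_eqF (ltn_ord k)).
case: eqP => //= ->; rewrite [X in X (+) _](_ : _ = false) //.
by apply/eqP; lia.
Qed.

(** Without descents [p] is strictly increasing, so it maps the elements below [i] onto those below
    [p i]; counting both sets gives [p i = i]. *)
Lemma pattern_count_false n : pattern_count n (fun=> false) = 1.
Proof.
rewrite -(card1 (1%g : 'S_n)); apply: eq_card => p; rewrite !inE.
apply/has_patternP/eqP => [H|-> j k kj]; last first.
  by rewrite !perm1 kj ltnNge leqnSn.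
have homo (i j : 'I_n) : i < j -> p i < p j.
  have [e] := ubnP (j - i); elim: e j => // e IHe j le_e lt_ij.
  have lt_jn : j.-1 < n by rewrite (leq_ltn_trans (leq_pred _)).
  pose j' := Ordinal lt_jn; have jj' : j = j'.+1 :> nat by rewrite /=; lia.
  have lt_j'j : p j' < p j.
    rewrite ltn_neqAle leqNgt (H j' j) // andbT; apply/eqP.
    by move=> /val_inj/perm_inj E; move: jj'; rewrite -E; lia.
  have [ij'|lt_ij'] := eqVneq i j'; first by rewrite ij'.
  apply: ltn_trans lt_j'j; apply: IHe; first by rewrite /=; lia.
  by rewrite ltn_neqAle lt_ij' /= -ltnS -jj'.
have E (i j : 'I_n) : (p i < p j) = (i < j).
  have [/homo //|/homo/ltnW|/val_inj->] := ltngtP i j; last by rewrite ltnn.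
  by rewrite leqNgt => /negbTE.
have card_lt (x : 'I_n) : #|[pred y : 'I_n | y < x]| = x.
  rewrite -sum1_card -(big_ord_widen n (fun=> 1) (ltnW (ltn_ord x))).
  by rewrite sum_nat_const card_ord muln1.
apply/permP => i; rewrite perm1; apply/val_inj.
rewrite /= -[LHS]card_lt -[RHS]card_lt -[RHS](card_imset _ (@perm_inj _ p)).
apply: eq_card => y; rewrite !inE; apply/idP/imsetP => [lt_y|[x]].
  by exists (p^-1 y)%g; rewrite ?permKV // inE -E permKV.
by rewrite inE => lt_x ->; rewrite E.
Qed.
End Patterns.

(** * Proportions of permutations and the gluing identity *)

Section Density.
Context {R : realType}.
Implicit Types (V W : nat -> bool) (m n : nat).

Definition density n W : R := (pattern_count n W)%:R / n`!%:R.

Lemma eq_density n V W :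
  (forall i, (0 < i < n)%N -> V i = W i) -> density n V = density n W.
Proof. by move=> VW; rewrite /density (eq_pattern_count VW). Qed.

Lemma density_ge0 n W : 0 <= density n W.
Proof. by rewrite divr_ge0. Qed.

Lemma density_flip m n W : (0 < m)%N -> (0 < n)%N ->
  density (m + n) W + density (m + n) (flip m W) =
  density m W * density n (fun i => W (m + i)%N).
Proof.
case: m n => // m [//|n] _ _; rewrite /density -mulrDl -natrD pattern_count_flip.
have := @card_split_pattern m.+1 n.+1 W.
move: (fact_gt0 m.+1) (fact_gt0 n.+1) (fact_gt0 (m.+1 + n.+1)).
move: (m.+1`!) (n.+1`!) ((m.+1 + n.+1)`!) #|_| => a b c x a0 b0 c0.
move/(congr1 (fun k : nat => k%:R : R)); rewrite !natrM => E.
have nz k : (0 < k)%N -> k%:R != 0 :> R by rewrite pnatr_eq0 lt0n.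
apply: (mulfI (nz _ a0)); apply: (mulfI (nz _ b0)); apply: (mulfI (nz _ c0)).
transitivity (a%:R * b%:R * x%:R : R); first by field; rewrite nz.
by rewrite E; field; rewrite !nz.
Qed.

Lemma density_false n : density n (fun=> false) = n`!%:R^-1.
Proof. by rewrite /density pattern_count_false mul1r. Qed.

Lemma density1 W : density 1 W = 1.
Proof.
rewrite (@eq_density _ _ (fun=> false)) ?density_false ?invr1 //.
by case=> [|[]].
Qed.

Lemma density_cat_le m n W : (0 < m)%N -> (0 < n)%N ->
  density (m + n) W <= density m W * density n (fun i => W (m + i)%N).
Proof. by move=> m0 n0; rewrite -density_flip // lerDl density_ge0. Qed.

(** One more position is a block of length 1, whose density is 1, so submultiplicativity applies. *)
Lemma density_nonincreasing W m n : (0 < m)%N -> (m <= n)%N ->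
  density n W <= density m W.
Proof.
move=> m0 /subnKC <-; elim: (n - m)%N => [|k IHk]; first by rewrite addn0.
apply: le_trans IHk; rewrite addnS -addn1.
apply: le_trans (density_cat_le _ _ _) _ => //; first by rewrite addn_gt0 m0.
by rewrite density1 mulr1.
Qed.

Lemma density_d n (I : set nat) :
  density n (fun i => `[< I i >]) = (d n I)%:R / n`!%:R.
Proof. by rewrite /density d_pattern_count. Qed.

(** * Alternating permutations and the secant recurrence *)

Definition up_down : nat -> bool := fun i => ~~ odd i.

(* The Taylor coefficient of [x^(2n)] in the secant. *)
Definition euler_coef n : R := density n.*2 up_down.

Definition alternating_then_rising j k : R :=
  density (j.*2 + k.*2) (fun i => (i <= j.*2)%N && up_down i).

(** Gluing an alternating and a rising block at [j.*2]: a descent there gives the first summand. An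
    ascent extends the rising part back to [j.*2 - 2], since the odd letter [j.*2 - 1] is already an
    ascent, and gives the second. *)
Lemma alternating_then_rising_cat j k : (0 < j)%N -> (0 < k)%N ->
  alternating_then_rising j k + alternating_then_rising j.-1 k.+1 =
  euler_coef j / (k.*2)`!%:R.
Proof.
move=> j0 k0; rewrite -density_false.
rewrite [euler_coef _](@eq_density _ _
    (fun i => (i <= j.*2)%N && up_down i)); last first.
  by move=> i /andP[_ /ltnW ->].
rewrite (@eq_density k.*2 _ (fun i => (j.*2 + i <= j.*2)%N &&
    up_down (j.*2 + i))); last first.
  by move=> [|i] // _; rewrite addnS ltnNge leq_addr.
rewrite -density_flip ?double_gt0 //; congr (_ + _).
rewrite /alternating_then_rising.
rewrite (_ : j.-1.*2 + k.+1.*2 = j.*2 + k.*2)%N; last by lia.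
apply: eq_density => i _; rewrite /flip /up_down.
case: eqP => [->|] /=; first by rewrite odd_double leqnn /=; case: leqP => //; lia.
move=> /eqP ne; case: (boolP (odd i)) => [|ev]; first by rewrite !andbF.
by rewrite !andbT /=; lia.
Qed.

Lemma alternating_then_rising0 n : alternating_then_rising n 0 = euler_coef n.
Proof.
rewrite /alternating_then_rising addn0; apply: eq_density => i /andP[_ /ltnW].
by move->.
Qed.

Lemma alternating_then_rising_last n :
  alternating_then_rising n 1 = euler_coef n.+1.
Proof.
rewrite /alternating_then_rising /euler_coef addn2 doubleS.
apply: eq_density => i /andP[_ lt_i]; rewrite /up_down.
case: (leqP i n.*2) => //= lt_ni.
have -> : i = n.*2.+1 by lia.
by rewrite /= odd_double.
Qed.

Lemma alternating_then_rising_all n :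
  alternating_then_rising 0 n = (n.*2)`!%:R^-1.
Proof.
rewrite -density_false; apply: eq_density => i /andP[i0 _].
by rewrite leqn0 eqn0Ngt i0.
Qed.

(** Coefficientwise, this is the identity [sec * cos = 1]. *)
Lemma euler_coef_rec n : (0 < n)%N ->
  \sum_(k < n.+1) (-1) ^+ k * euler_coef (n - k) / (k.*2)`!%:R = 0 :> R.
Proof.
case: n => // n _.
pose c k : R := (k.*2)`!%:R^-1.
have c0 : c 0 = 1 by rewrite /c fact0 invr1.
have cat j k : (0 < j)%N -> (0 < k)%N ->
    alternating_then_rising j k + alternating_then_rising j.-1 k.+1 =
    euler_coef j * c k by exact: alternating_then_rising_cat.
have all k : alternating_then_rising 0 k = c k.
  exact: alternating_then_rising_all.
under eq_bigr => k _ do rewrite -/(c k).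
clearbody c.
(* Each product splits by [cat] into two neighbouring terms, and the alternating signs cancel all
   but the last one. The sum starts with [alternating_then_rising n 1], which is the term
   [k = 0]. *)
have partial m : (m <= n)%N ->
    \sum_(k < m.+1) (-1) ^+ k * euler_coef (n.+1 - k) * c k =
    (-1) ^+ m * alternating_then_rising (n - m) m.+1.
  elim: m => [_|m IHm lt_mn].
    rewrite big_ord_recl big_ord0 subn0 expr0 c0 mulr1 addr0 !mul1r subn0.
    by rewrite alternating_then_rising_last.
  rewrite big_ord_recr /= (IHm (ltnW lt_mn)) -mulrA -cat ?subn_gt0 //.
  by rewrite subSS subnS exprS; ring.
rewrite big_ord_recr /= partial // subnn all.
rewrite -alternating_then_rising0 subnn all c0.
by rewrite exprS; ring.
Qed.

End Density.

(** * Two-sided bounds for the secant coefficients *)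

Section Growth.
Context {R : realType}.

Lemma is_derive_ndecr (f df : R -> R) (a b : R) :
  (forall x : R, is_derive x 1 f (df x)) ->
  (forall x, a <= x <= b -> 0 <= df x) ->
  forall x y, a <= x -> x <= y -> y <= b -> f x <= f y.
Proof.
move=> dfx df0; apply: ger0_derive1_ndecr => [x _|x|].
- exact: (@ex_derive _ _ _ _ _ _ _ (dfx x)).
- rewrite in_itv /= => /andP[/ltW ax /ltW xb].
  by rewrite derive1E (@derive_val _ _ _ _ _ _ _ (dfx x)) df0 // ax.
- apply: continuous_subspaceT => x.
  apply/differentiable_continuous/derivable1_diffP.
  exact: (@ex_derive _ _ _ _ _ _ _ (dfx x)).
Qed.

(** As [g] increases from 0, it is nonnegative, so [f] decreases on [[0, 1]] down to [f 1 = 0]. *)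
Lemma concave_ge0 (f g h : R -> R) :
  (forall x : R, is_derive x 1 f (- g x)) -> (forall x : R, is_derive x 1 g (h x)) ->
  g 0 = 0 -> f 1 = 0 -> (forall x, 0 <= x <= 1 -> 0 <= h x) ->
  forall x, 0 <= x <= 1 -> 0 <= f x.
Proof.
move=> df dg g0 f1 h0 x /andP[x0 x1].
have g_ge0 y : 0 <= y <= 1 -> 0 <= g y.
  move=> /andP[y0 y1]; rewrite -[leLHS]g0.
  exact: (is_derive_ndecr dg h0).
rewrite -lerN2 oppr0 -oppr0 -{1}f1.
apply: (@is_derive_ndecr (fun t => - f t) g 0 1) => // y.
by rewrite -[g y]opprK; apply: is_deriveN.
Qed.

Lemma is_derive_comp_scale (f : R -> R) (df th x : R) :
  is_derive (th * x) 1 f df -> is_derive x 1 (fun t => f (th * t)) (th * df).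
Proof.
move=> dfx; rewrite mulrC; apply: (@is_derive1_comp R f (fun t => th * t)).
have : is_derive x 1 (th *: (@id R)) (th *: 1) by apply: is_deriveZ.
by rewrite [th *: 1]mulr1.
Qed.

Lemma is_derive_monomial (a x : R) n :
  is_derive x 1 (fun t => a * t ^+ n.+1) (a * n.+1%:R * x ^+ n).
Proof.
have : is_derive x 1 (a *: ((@id R) ^+ n.+1)) (a *: ((n.+1%:R * x ^+ n) *: 1)).
  exact: is_deriveZ.
rewrite [_ *: 1]mulr1 -mulrA; congr is_derive.
by apply/funext => t; rewrite -[LHS]/(a * ((@id R) ^+ n.+1) t) exprfctE.
Qed.

Context (e : nat -> R).

(** With the formal series [E(t) = sum_k e_k t^(2k)], these are the coefficients of [t^(2n)] in
    [E(t) cos(tx)] and, for [sine_sum], of [t^(2n+1)] in [E(t) sin(tx)]. *)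
Definition cosine_sum n (x : R) : R :=
  \sum_(k < n.+1) (-1) ^+ k * e (n - k) / (k.*2)`!%:R * x ^+ k.*2.

Definition sine_sum n (x : R) : R :=
  \sum_(k < n.+1) (-1) ^+ k * e (n - k) / (k.*2.+1)`!%:R * x ^+ k.*2.+1.

Lemma factSV n : n.+1`!%:R^-1 * n.+1%:R = n`!%:R^-1 :> R.
Proof.
by rewrite factS natrM invfM mulrAC mulVf ?mul1r.
Qed.

Lemma is_derive_fun_sum n (h dh : 'I_n -> R -> R) (x : R) :
  (forall i, is_derive x 1 (h i) (dh i x)) ->
  is_derive x 1 (fun t => \sum_(i < n) h i t) (\sum_(i < n) dh i x).
Proof.
move=> H; have := is_derive_sum (fun i => H i); congr is_derive.
by apply/funext => t; rewrite fct_sumE.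
Qed.

Lemma is_derive_sine_sum n (x : R) :
  is_derive x 1 (sine_sum n) (cosine_sum n x).
Proof.
apply: (@is_derive_fun_sum _
  (fun (k : 'I_n.+1) t => (-1) ^+ k * e (n - k) / (k.*2.+1)`!%:R * t ^+ k.*2.+1)
  (fun (k : 'I_n.+1) t => (-1) ^+ k * e (n - k) / (k.*2)`!%:R * t ^+ k.*2)).
move=> k; rewrite -(factSV k.*2) mulrA; exact: is_derive_monomial.
Qed.

Lemma is_derive_cosine_sum n (x : R) :
  is_derive x 1 (cosine_sum n.+1) (- sine_sum n x).
Proof.
have -> : cosine_sum n.+1 = (cst (e n.+1)) + (fun t => \sum_(k < n.+1)
    (-1) ^+ k.+1 * e (n - k) / (k.*2.+2)`!%:R * t ^+ k.*2.+2).
  apply/funext => t; rewrite /cosine_sum big_ord_recl.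
  by rewrite expr0 subn0 fact0 divr1 mul1r mulr1.
rewrite -[- sine_sum n x]add0r; apply: is_deriveD.
rewrite /sine_sum -sumrN.
apply: (@is_derive_fun_sum _
  (fun (k : 'I_n.+1) t =>
    (-1) ^+ k.+1 * e (n - k) / (k.*2.+2)`!%:R * t ^+ k.*2.+2)
  (fun (k : 'I_n.+1) t =>
    - ((-1) ^+ k * e (n - k) / (k.*2.+1)`!%:R * t ^+ k.*2.+1))).
move=> k; rewrite -(factSV k.*2.+1) -!mulNr mulrA.
by rewrite -[- (-1) ^+ k]mulN1r -exprS; exact: is_derive_monomial.
Qed.

Lemma sine_sum0 n : sine_sum n 0 = 0.
Proof. by rewrite /sine_sum big1 // => k _; rewrite expr0n mulr0. Qed.

Lemma cosine_sum_at0 n : cosine_sum n 0 = e n.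
Proof.
rewrite /cosine_sum big_ord_recl big1 => [|k _].
  by rewrite expr0 subn0 fact0 divr1 mul1r mulr1 addr0.
by rewrite expr0n mulr0.
Qed.

Context (e0 : e 0 = 1).
Context (e_rec : forall n, (0 < n)%N ->
  \sum_(k < n.+1) (-1) ^+ k * e (n - k) / (k.*2)`!%:R = 0).

Lemma cosine_sum_at1 n : cosine_sum n.+1 1 = 0.
Proof.
by rewrite -[RHS](e_rec (ltn0Sn n)); apply: eq_bigr => k _; rewrite expr1n mulr1.
Qed.

Let th : R := pi / 2.

Let th_gt0 : 0 < th.
Proof. by rewrite divr_gt0 ?pi_gt0. Qed.

(* Taking [a = 1, b < 0] bounds [e n] from below, [a = -1, b > 0] from above. *)
Lemma cosine_sum_compare a b n :
  (forall x, 0 <= x <= 1 ->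
    0 <= a * cosine_sum n x + b * th^-1 ^+ n.*2 * cos (th * x)) ->
  forall x, 0 <= x <= 1 ->
    0 <= a * cosine_sum n.+1 x + b * th^-1 ^+ n.+1.*2 * cos (th * x).
Proof.
move=> H; set c := b * th^-1 ^+ n.+1.*2.
(* Differentiating [cos (th * x)] twice produces [th ^+ 2], which turns the coefficient for [n.+1]
   into the one for [n]. *)
have cE : b * th^-1 ^+ n.*2 = c * th * th.
  by rewrite /c doubleS !exprS; field; rewrite gt_eqF.
clearbody c.
apply: (concave_ge0
  (g := fun x => a * sine_sum n x + c * (th * sin (th * x)))
  (h := fun x => a * cosine_sum n x + c * th * th * cos (th * x))).
- move=> x; rewrite opprD -!mulrN.
  apply: (@is_deriveD _ _ _ (a *: cosine_sum n.+1)
    (c *: (fun t => cos (th * t)))).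
    exact/is_deriveZ/is_derive_cosine_sum.
  exact/is_deriveZ/is_derive_comp_scale.
- move=> x.
  apply: (@is_deriveD _ _ _ (a *: sine_sum n)
    (c *: (th *: (fun t => sin (th * t))))).
    exact/is_deriveZ/is_derive_sine_sum.
  rewrite -(mulrA (c * th) th) -(mulrA c th).
  exact/is_deriveZ/is_deriveZ/is_derive_comp_scale.
- by rewrite sine_sum0 (mulr0 th) sin0 !mulr0 addr0.
- by rewrite cosine_sum_at1 mulr1 cos_pihalf !mulr0 addr0.
- by move=> x x01; rewrite -cE; exact: H.
Qed.

(** The comparison starts from [cos <= 1 = cosine_sum 0] and is read off at [x = 0]. *)
Lemma secant_coef_ge n : (2 / pi) ^+ n.*2 <= e n.
Proof.
have H x : 0 <= x <= 1 ->
    0 <= 1 * cosine_sum n x + -1 * th^-1 ^+ n.*2 * cos (th * x).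
  elim: n x => [x _|n IHn]; last exact: cosine_sum_compare.
  rewrite /cosine_sum big_ord_recl big_ord0 !expr0 subnn e0 fact0.
  by rewrite divr1 addr0 !mulr1 mulN1r subr_ge0 cos_le1.
have := H 0; rewrite cosine_sum_at0 mulr0 cos0 mulr1 mul1r mulN1r.
by rewrite subr_ge0 /th invf_div; apply; rewrite lexx ler01.
Qed.

Lemma mul_cos_le_sin (y : R) : 0 <= y <= th -> y * cos y <= sin y.
Proof.
move=> /andP[y0 yth]; rewrite -subr_ge0.
have -> : 0 = sin (0 : R) - 0 * cos 0 by rewrite sin0 mul0r subr0.
apply: (@is_derive_ndecr (fun t => sin t - t * cos t)
  (fun t => t * sin t) 0 th) => // t.
  have : is_derive t 1 (@sin R - @id R * @cos R)
      (cos t - (t *: (- sin t) + cos t *: 1)).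
    exact: is_deriveB.
  congr is_derive; rewrite /GRing.scale /=; ring.
move=> /andP[t0 tth]; rewrite mulr_ge0 // sin_ge0_pi // t0.
by move: tth pi_ge0; rewrite /th; lra.
Qed.

(** With [z = y / 2], [sin y = 2 sin z cos z >= 2 z (cos z)^2 = z (1 + cos y) >= z]. *)
Lemma half_le_sin (y : R) : 0 <= y <= th -> y / 2 <= sin y.
Proof.
move=> /andP[y0 yth].
pose z := y / 2; have yz : y = z *+ 2 by rewrite -mulr_natr divfK.
have z0 : 0 <= z by rewrite divr_ge0.
have zth : z <= th by rewrite /z; lra.
have cosy : 0 <= cos y.
  by rewrite cos_ge0_pihalf // -/th yth andbT (le_trans _ y0) // oppr_le0 ltW.
have cosz : 0 <= cos z.
  by rewrite cos_ge0_pihalf // -/th zth andbT (le_trans _ z0) // oppr_le0 ltW.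
have : z * cos z <= sin z by rewrite mul_cos_le_sin ?z0.
move: cosy; rewrite -/z yz cos_mulr2n sin_mulr2n !mulr2n.
nra.
Qed.

(** The comparison starts at index 1: the constant [cosine_sum 0] does not vanish at 1, so no
    multiple of the cosine dominates it. There [(1 - x^2) / 2 <= 1 - x <= (2 / th) sin (th (1 -
    x))], whence the factor [2 / th]; the factor [th ^+ 2] offsets the initial [th^-1 ^+ 2]. *)
Lemma secant_coef_le n : e n.+1 <= 2 / th * th ^+ 2 * (2 / pi) ^+ n.+1.*2.
Proof.
have H x : 0 <= x <= 1 -> 0 <= -1 * cosine_sum n.+1 x +
    (2 / th * th ^+ 2) * th^-1 ^+ n.+1.*2 * cos (th * x).
  elim: n x => [x /andP[x0 x1]|n IHn]; last exact: cosine_sum_compare.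
  have -> : cosine_sum 1 x = (1 - x ^+ 2) / 2.
    have := cosine_sum_at1 0.
    rewrite /cosine_sum !big_ord_recl !big_ord0 /= !expr0 !expr1 !subn0 subnn.
    rewrite e0 fact0 expr1n -[(bump 0 0).*2]/2%N (_ : 2`! = 2%N) //; lra.
  have -> : 2 / th * th ^+ 2 * th^-1 ^+ 1.*2 = 2 / th.
    by field; rewrite gt_eqF.
  have -> : cos (th * x) = sin (th * (1 - x)).
    by rewrite -cosBpihalf -/th mulrBr mulr1 addrAC subrr add0r cosN.
  have : th * (1 - x) / 2 <= sin (th * (1 - x)).
    apply: half_le_sin; rewrite mulr_ge0 ?subr_ge0 ?(ltW th_gt0) //=.
    by rewrite ler_piMr ?(ltW th_gt0) // gerBl.
  have pos : 0 <= 2 / th by rewrite divr_ge0 // ltW.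
  move/(ler_wpM2l pos).
  have -> : 2 / th * (th * (1 - x) / 2) = 1 - x.
    by field; rewrite gt_eqF.
  nra.
have := H 0; rewrite cosine_sum_at0 mulr0 cos0 mulr1 mulN1r addrC.
by rewrite subr_ge0 /th invf_div; apply; rewrite lexx ler01.
Qed.

End Growth.

(** * Limits of n-th roots *)

Section RootLimits.
Context {R : realType}.

Lemma cvg_natV : n%:R^-1 @[n --> \oo] --> (0 : R).
Proof.
apply: (gtr0_cvgV0 _).2; last exact: cvgr_idn.
by near=> n; rewrite ltr0n; near: n; exact: nbhs_infty_gt.
Unshelve. all: by end_near. Qed.

Lemma cvg_powR_natV (c : R) : 0 < c -> c `^ n%:R^-1 @[n --> \oo] --> (1 : R).
Proof.
move=> c0; rewrite -[X in _ --> X]expR0 -[X in expR X](mul0r (ln c)).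
under eq_fun do rewrite /powR gt_eqF //.
apply: continuous_cvg; first exact: continuous_expR.
by apply: cvgM; [exact: cvg_natV|exact: cvg_cst].
Qed.

Lemma exprn_powR_natV (x : R) n : 0 <= x -> (0 < n)%N ->
  (x ^+ n) `^ n%:R^-1 = x.
Proof.
move=> x0 n0; rewrite -powR_mulrn // -powRrM mulfV ?powRr1 //.
by rewrite pnatr_eq0 -lt0n.
Qed.

(** The constants disappear because their n-th roots tend to 1. *)
Lemma cvg_root_geometric (a : nat -> R) (L c C : R) : 0 < L -> 0 < c ->
  (\forall n \near \oo, c * L ^+ n <= a n <= C * L ^+ n) ->
  (a n) `^ n%:R^-1 @[n --> \oo] --> L.
Proof.
move=> L0 c0 acC.
have C0 : 0 < C.
  have [n] := filter_ex acC; move=> /andP[ca aC].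
  have : 0 < C * L ^+ n.
    by rewrite (lt_le_trans _ (le_trans ca aC)) // mulr_gt0 // exprn_gt0.
  by rewrite pmulr_lgt0 // exprn_gt0.
apply: (@squeeze_cvgr _ _ _ _ (fun n => c `^ n%:R^-1 * L)
                              (fun n => C `^ n%:R^-1 * L)).
- near=> n.
  have n0 : (0 < n)%N by near: n; exact: nbhs_infty_gt.
  have /andP[ca aC] : c * L ^+ n <= a n <= C * L ^+ n by near: n.
  have cL0 : 0 <= c * L ^+ n by rewrite mulr_ge0 ?exprn_ge0 // ltW.
  have an0 := le_trans cL0 ca.
  have E k : 0 < k -> k `^ n%:R^-1 * L = (k * L ^+ n) `^ n%:R^-1.
    by move=> k0; rewrite powRM ?exprn_ge0 ?exprn_powR_natV // ltW.
  rewrite !E //; apply/andP; split; apply: ge0_ler_powR;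
    rewrite ?invr_ge0 ?nnegrE //.
  exact: le_trans aC.
- by rewrite -[X in _ --> X]mul1r; apply: cvgM;
    [exact: cvg_powR_natV|exact: cvg_cst].
- by rewrite -[X in _ --> X]mul1r; apply: cvgM;
    [exact: cvg_powR_natV|exact: cvg_cst].
Unshelve. all: by end_near. Qed.

(** With [q = n %/ l], monotonicity puts [a n] between the values at [q.+1 * l] and [q * l]. Both
    indices are within [l] of [n], so as [L <= 1] each side loses at most a factor [L ^+ l]. *)
Lemma cvg_root_multiples (a : nat -> R) (l : nat) (L c C : R) :
  (0 < l)%N -> 0 < L <= 1 -> 0 < c ->
  (forall m n, (0 < m <= n)%N -> a n <= a m) ->
  (forall k, c * L ^+ (k.+1 * l) <= a (k.+1 * l)%N <= C * L ^+ (k.+1 * l)) ->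
  (a n) `^ n%:R^-1 @[n --> \oo] --> L.
Proof.
move=> l0 /andP[L0 L1] c0 a_noninc a_bnd.
have C0 : 0 <= C.
  have /andP[ca aC] := a_bnd 0%N.
  have : 0 <= C * L ^+ (1 * l).
    by rewrite (le_trans _ (le_trans ca aC)) // mulr_ge0 ?exprn_ge0 // ltW.
  by rewrite pmulr_lge0 // exprn_gt0.
apply: (@cvg_root_geometric _ _ (c * L ^+ l) (C * L ^- l)) => //.
  by rewrite mulr_gt0 // exprn_gt0.
near=> n.
have ln : (l <= n)%N by near: n; exact: nbhs_infty_ge.
have q0 : (0 < n %/ l)%N by rewrite divn_gt0.
have qn := leq_divM n l.
have nq : (n <= (n %/ l).+1 * l)%N by rewrite ltnW // -ltn_divLR.
have /andP[lo _] := a_bnd (n %/ l)%N.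
have /andP[_ hi] := a_bnd (n %/ l).-1; rewrite prednK // in hi.
have lo' : a ((n %/ l).+1 * l)%N <= a n.
  by rewrite a_noninc // nq andbT (leq_trans l0).
have hi' : a n <= a (n %/ l * l)%N by rewrite a_noninc // muln_gt0 q0 l0.
apply/andP; split.
- apply: le_trans lo'; apply: le_trans lo; rewrite -mulrA -exprD ler_pM2l //.
  by rewrite ler_wiXn2l ?(ltW L0) // mulSn leq_add2l.
- apply: (le_trans hi'); apply: (le_trans hi); rewrite -mulrA ler_wpM2l // mulrC.
  rewrite ler_pdivlMr ?exprn_gt0 // -exprD ler_wiXn2l ?(ltW L0) //.
  by rewrite addnC -mulSn.
Unshelve. all: by end_near. Qed.

(** The quotient of the two sides is a term of the exponential series at [x^-1], hence tends to
    0. *)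
Lemma fact_inv_le_expr (x : R) : 0 < x ->
  \forall n \near \oo, n`!%:R^-1 <= x ^+ n.
Proof.
move=> x0; have /cvgr0Pnorm_le/(_ _ ltr01) := cvg_exp_coeff x^-1.
apply: filterS => n; rewrite /exp_coeff /= ger0_norm; last first.
  by rewrite divr_ge0 // exprn_ge0 // invr_ge0 ltW.
by rewrite exprVn mulrC ler_pdivrMr ?exprn_gt0 // mul1r.
Qed.

Lemma cvg_root_fact_inv : (n`!%:R^-1 : R) `^ n%:R^-1 @[n --> \oo] --> (0 : R).
Proof.
apply/cvgr0Pnorm_le => x x0; near=> n.
rewrite ger0_norm ?powR_ge0 //.
have n0 : (0 < n)%N by near: n; exact: nbhs_infty_gt.
rewrite -[leRHS](exprn_powR_natV (ltW x0) n0).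
apply: ge0_ler_powR; rewrite ?invr_ge0 ?nnegrE ?exprn_ge0 ?(ltW x0) //.
by near: n; exact: fact_inv_le_expr.
Unshelve. all: by end_near. Qed.

End RootLimits.

(** * The greedy word for intermediate limits *)

Section Greedy.
Context {R : realType}.

(* The bit in position [k] of a word is the pattern at [k]; bit 0 is ignored by
   [density], and becomes the gluing letter when the word is appended to
   another one. *)
Definition word_density (u : seq bool) : R := density (size u) (nth false u).

Definition flip_head (v : seq bool) := ~~ head false v :: behead v.

Definition append_best (u v : seq bool) :=
  u ++ if word_density (u ++ v) < word_density (u ++ flip_head v)
       then flip_head v else v.

Lemma size_append_best u v : (0 < size v)%N ->
  size (append_best u v) = (size u + size v)%N.
Proof. by case: v => // b v _; rewrite size_cat; case: ifP. Qed.

Lemma nth_append_best u v i : (i < size u)%N ->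
  nth false (append_best u v) i = nth false u i.
Proof. by move=> iu; rewrite nth_cat iu. Qed.

(** The two gluings have nonnegative densities adding up to the product, so the larger one is at
    least half of it. *)
Lemma append_best_bounds u v : (0 < size u)%N -> (0 < size v)%N ->
  word_density u * word_density v / 2 <= word_density (append_best u v)
    <= word_density u * word_density v.
Proof.
move=> u0 v0; have := @density_flip R _ _ (nth false (u ++ v)) u0 v0.
have -> : density (size u) (nth false (u ++ v)) = word_density u.
  by apply: eq_density => i /andP[_ iu]; rewrite nth_cat iu.
have -> : density (size v) (fun i => nth false (u ++ v) (size u + i)) =
    word_density v.
  by apply: eq_density => i _; rewrite nth_cat ltnNge leq_addr addKn.
have -> : density (size u + size v) (flip (size u) (nth false (u ++ v))) =
    word_density (u ++ flip_head v).
  rewrite /word_density size_cat /= size_behead prednK //.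
  apply: eq_density => i _; rewrite /flip !nth_cat.
  case: (ltngtP i (size u)) => // [ui|->]; last by rewrite subnn nth0.
  by rewrite -(subnSK ui) /= nth_behead.
rewrite -size_cat -/(word_density _) => <-; rewrite /append_best.
have := @density_ge0 R (size (u ++ v)) (nth false (u ++ v)).
have := @density_ge0 R (size (u ++ flip_head v)) (nth false (u ++ flip_head v)).
rewrite -!/(word_density _).
by case: ltP => ? ? ?; apply/andP; split; lra.
Qed.

Definition rising_block l := nseq l false.
Definition alternating_block l := mkseq up_down l.

Lemma word_density_rising l : word_density (rising_block l) = l`!%:R^-1.
Proof.
rewrite -density_false /word_density size_nseq; apply: eq_density => i _.
by rewrite nth_nseq if_same.
Qed.

Lemma word_density_alternating l :
  word_density (alternating_block l) = density l up_down.
Proof.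
rewrite /word_density size_mkseq; apply: eq_density => i /andP[_ il].
by rewrite nth_mkseq.
Qed.

Fixpoint greedy (L : R) (l k : nat) : seq bool :=
  if k is k'.+1 then
    let u := greedy L l k' in
    append_best u (if L ^+ size u < word_density u
                   then rising_block l else alternating_block l)
  else rising_block l.

(** For [0 < l] the word [greedy L l i] has [i.+1 * l > i] letters, and later words keep its letter
    at [i]. *)
Definition greedy_limit (L : R) (l i : nat) : bool :=
  nth false (greedy L l i) i.

Lemma size_greedy L l k : (0 < l)%N -> size (greedy L l k) = (k.+1 * l)%N.
Proof.
move=> l0; elim: k => [|k IHk]; first by rewrite size_nseq mul1n.
rewrite /= size_append_best IHk; last by case: ifP; rewrite ?size_nseq ?size_mkseq.
by case: ifP; rewrite ?size_nseq ?size_mkseq -mulSnr.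
Qed.

Lemma nth_greedy L l j k i : (0 < l)%N -> (j <= k)%N -> (i < j.+1 * l)%N ->
  nth false (greedy L l k) i = nth false (greedy L l j) i.
Proof.
move=> l0 /subnKC <- ij; elim: (k - j)%N => [|n IHn]; first by rewrite addn0.
rewrite addnS /= nth_append_best // size_greedy // (leq_trans ij) //.
by rewrite leq_mul2r ltnS leq_addr orbT.
Qed.

Lemma density_greedy_limit L l k : (0 < l)%N ->
  density (k.+1 * l) (greedy_limit L l) = word_density (greedy L l k).
Proof.
move=> l0; rewrite /word_density size_greedy //.
apply: eq_density => i /andP[_ ik]; rewrite /greedy_limit.
have ii : (i < i.+1 * l)%N by rewrite leq_pmulr.
by case/orP: (leq_total i k) => le_ik; [rewrite (nth_greedy L l0 le_ik)|
   rewrite (nth_greedy L l0 le_ik)].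
Qed.

Lemma greedy_bounds (L : R) (l k : nat) : (0 < l)%N -> 0 < L <= 1 ->
  l`!%:R^-1 <= L ^+ l -> 2 * L ^+ l <= density l up_down ->
  l`!%:R^-1 / 2 * L ^+ (k.+1 * l) <= word_density (greedy L l k)
    <= L ^- l * L ^+ (k.+1 * l).
Proof.
move=> l0 /andP[L0 L1] rise alt.
have Ll0 : 0 < L ^+ l by rewrite exprn_gt0.
have Ll1 : L ^+ l <= 1 by rewrite exprn_ile1 // ltW.
have r0 : 0 < l`!%:R^-1 :> R by rewrite invr_gt0 ltr0n fact_gt0.
elim: k => [|k /andP[IHlo IHhi]].
  rewrite mul1n mulVf ?gt_eqF // word_density_rising; apply/andP; split; nra.
rewrite /= size_greedy // mulSn exprD.
set u := greedy L l k in IHlo IHhi *; set x := L ^+ (k.+1 * l) in IHlo IHhi *.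
have x0 : 0 < x by rewrite exprn_gt0.
have su : (0 < size u)%N by rewrite size_greedy // muln_gt0.
have inv : L ^- l * L ^+ l = 1 by rewrite mulVf ?gt_eqF.
have Llinv0 : 0 < L ^- l by rewrite invr_gt0.
case: ltP => cmp.
  (* Here [x < word_density u] gives the lower bound afresh, while [rise] preserves the upper
     bound. *)
  have := @append_best_bounds u (rising_block l) su.
  rewrite size_nseq word_density_rising => /(_ l0) /andP[lo hi].
  have px : L ^+ l * x <= x by rewrite ler_piMl // ltW.
  have := ler_wpM2l (ltW r0) (le_trans px (ltW cmp)).
  have := ler_pM (ltW (lt_trans x0 cmp)) (ltW r0) IHhi rise.
  by move=> hi' lo'; apply/andP; split; lra.
(* Here [word_density u <= x] gives the upper bound afresh. The 2 in [alt] pays for the gluing,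
   which preserves the lower bound. *)
have := @append_best_bounds u (alternating_block l) su.
rewrite size_mkseq word_density_alternating => /(_ l0) /andP[lo hi].
have u0 : 0 <= word_density u by exact: density_ge0.
have d1 : density l up_down <= 1 :> R.
  by rewrite -(density1 up_down) density_nonincreasing.
have := ler_wpM2r (ltW Ll0) IHlo; have := ler_wpM2l u0 alt.
have := ler_wpM2l u0 d1; rewrite [L ^- l * _]mulrA inv mul1r => hi' lo' lo''.
by apply/andP; split; lra.
Qed.

End Greedy.

(** * From patterns to sets, and the choice of block length *)

Section Realization.
Context {R : realType}.

Lemma euler_coef0 : euler_coef 0 = 1 :> R.
Proof.
rewrite /euler_coef (@eq_density _ _ _ (fun=> false)) => [|i /andP[_ //]].
by rewrite density_false fact0 invr1.
Qed.

(** Removing 0 from the set is harmless, as the density ignores bit 0. *)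
Lemma realize_pattern (L : R) (W : nat -> bool) :
  (density n W : R) `^ n%:R^-1 @[n --> \oo] --> L ->
  exists I : set nat, I `<=` [set i | (1 <= i)%N] /\
    ((d n I)%:R / (n`!)%:R : R) `^ (n%:R^-1) @[n --> \oo] --> L.
Proof.
move=> WL; exists [set i | (0 < i)%N && W i]; split=> [i /= /andP[]//|].
under eq_fun => n.
  rewrite -density_d (@eq_density _ _ _ W) => [|i /andP[i0 _]]; last first.
    by apply/asboolP/idP => /=; rewrite i0.
  over.
exact: WL.
Qed.

Lemma block_length (L : R) : 0 < L < 2 / pi ->
  exists l, [/\ (0 < l)%N, l`!%:R^-1 <= L ^+ l & 2 * L ^+ l <= density l up_down].
Proof.
move=> /andP[L0 Lpi]; have q0 : 0 < 2 / pi :> R by rewrite divr_gt0 ?pi_gt0.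
have [N _ HN] := fact_inv_le_expr L0.
have half0 : 0 < 2^-1 :> R by rewrite invr_gt0 ltr0n.
have r0 : 0 <= L / (2 / pi) by rewrite divr_ge0 // ltW.
have r1 : `|L / (2 / pi)| < 1 by rewrite ger0_norm // ltr_pdivrMr // mul1r.
(* Powers of the ratio [L / (2 / pi) < 1] eventually absorb the factor 2. The length chosen below is
   even, so that [secant_coef_ge] applies. *)
have /cvgr0Pnorm_le/(_ _ half0)[M _ HM] := cvg_expr r1.
pose n := (N + M).+1; exists n.*2; split; first by rewrite double_gt0.
  by apply: HN; rewrite /= /n; lia.
have Mn : (M <= n.*2)%N by rewrite /n; lia.
have := HM _ Mn; rewrite /= ger0_norm ?exprn_ge0 //.
rewrite expr_div_n ler_pdivrMr ?exprn_gt0 // => H.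
apply: le_trans (secant_coef_ge euler_coef0 euler_coef_rec n).
by move: H; lra.
Qed.

End Realization.

Theorem theorem1p2 (R : realType) (L : R) (hL : 0 <= L <= 2 / pi) :
  exists I : set nat,
    I `<=` [set i | (1 <= i)%N] /\
    ((d n I)%:R / (n`!)%:R : R) `^ (n%:R^-1) @[n --> \oo] --> L.
Proof.
have q0 : 0 < 2 / pi :> R by rewrite divr_gt0 ?pi_gt0.
have q1 : 2 / pi <= 1 :> R by rewrite ler_pdivrMr ?pi_gt0 // mul1r pi_ge2.
have noninc W m n : (0 < m <= n)%N -> density n W <= density m W :> R.
  by move=> /andP[]; exact: density_nonincreasing.
move: hL; rewrite le_eqVlt => /andP[/orP[/eqP <- _|L0]].
  apply: (@realize_pattern _ _ (fun=> false)).
  under eq_fun do rewrite density_false.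
  exact: cvg_root_fact_inv.
rewrite le_eqVlt => /orP[/eqP ->|Lpi].
  apply: (@realize_pattern _ _ up_down).
  (* The secant bounds concern even lengths, hence the multiples of 2. *)
  apply: (@cvg_root_multiples _ _ 2%N _ 1 (2 / (pi / 2) * (pi / 2) ^+ 2)) => //.
  - by rewrite q0.
  - exact: noninc.
  move=> k; rewrite muln2 mul1r -/(euler_coef _).
  rewrite (secant_coef_ge euler_coef0 euler_coef_rec).
  exact: secant_coef_le euler_coef0 euler_coef_rec _.
have [|l [l0 rise alt]] := @block_length _ L; first by rewrite L0.
have L01 : 0 < L <= 1 by rewrite L0 (le_trans (ltW Lpi)).
apply: (@realize_pattern _ _ (greedy_limit L l)).
apply: (@cvg_root_multiples _ _ l _ (l`!%:R^-1 / 2) (L ^- l)) => //.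
  exact: noninc.
by move=> k; rewrite density_greedy_limit // greedy_bounds.
Qed.
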